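(* Let $\bar t\in(0,\tfrac12)$, $B>0$, $\bar m_2>0$, $\kappa\ge0$, $\varepsilon\in\left(0,\min\left(\tfrac{2\bar t}{1+2\bar t},\tfrac1B\right)\right)$, and $F\in\mathcal{F}_{\bar t,B,\bar m_2,\kappa}$. Let $Y_i\sim F$ and $D_i\sim\mathrm{Ber}(\varepsilon)$, for $i\in[n]$, all be drawn independently. Let $\{Z_i\}_{i\in[n]}$ be arbitrary random variables possibly depending on $\{Y_i,D_i\}_{i\in[n]}$, and define $X_i=(1-D_i)Y_i+D_iZ_i$. Then, for any confidence level $\delta>0$, any error level $E>0$, and any number of samples $$n\ge 2\max\left(\frac{16\kappa^2B^2\bar m_2^2}{E^2},\left(\min\left(\bar t,\tfrac1B\right)-\tfrac{\varepsilon}{2(1-\varepsilon)}\right)^{-2}\right)\log\frac4\delta,$$ we have $$\mathbb{P}\Big(\left|\hat m_2(X_1,\dots,X_n)-m_2(F)\right|\le(1+2\kappa)\,B\,m_2(F)\,\frac{\varepsilon}{2(1-\varepsilon)}+E\Big)\ge1-\delta .$$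
   Context: Distributions are on $\mathbb{R}$ and identified with their cdfs; $[n]=\{1,\dots,n\}$. For a cdf $F$, $Q_{L,F}(p)=\inf\{x:F(x)\ge p\}$ and $Q_{R,F}(p)=\inf\{x:F(x)>p\}$. For $X\sim F$: $m_1(F)$ is the median of $F$ (when unique), $m_2(F)$ is the median of $|X-m_1(F)|$ (the median absolute deviation, MAD), and, when $m_2(F)$ is unique, $m_4(F)$ is the median of $\big||X-m_1(F)|-m_2(F)\big|$. The empirical median $\hat m_1(x_1,\dots,x_n)$ is the middle value if $n$ is odd and the average of the two middle values if $n$ is even; the empirical MAD is $\hat m_2(x_1,\dots,x_n)=\hat m_1(|x_1-\hat m|,\dots,|x_n-\hat m|)$ with $\hat m=\hat m_1(x_1,\dots,x_n)$. For $\bar t\in(0,\tfrac12)$, $B>0$, $\bar m_2>0$, $\kappa\ge0$, $\mathcal{F}_{\bar t,B,\bar m_2,\kappa}$ is the family of distributions $F$ with unique $m_1(F),m_2(F),m_4(F)$ such that: (i) $|F(x_1)-F(x_2)|\ge\frac{1}{B\,m_2(F)}|x_1-x_2|$ for all $x_1,x_2\in\left[Q_{L,F}(\tfrac12-\bar t),Q_{R,F}(\tfrac12+\bar t)\right]\cup\left[m_1(F)-2m_2(F),m_1(F)+2m_2(F)\right]$; (ii) $m_2(F)\le\bar m_2$; (iii) $m_2(F)\le\kappa\,m_4(F)$. *)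

(* Defs.v *)
From HB Require Import structures.
From mathcomp Require Import all_boot all_order all_algebra.
From mathcomp Require Import all_classical all_reals all_analysis.

Set Implicit Arguments.
Unset Strict Implicit.
Unset Printing Implicit Defensive.

Import Order.TTheory GRing.Theory Num.Theory.
Import numFieldNormedType.Exports.

Local Open Scope classical_set_scope.
Local Open Scope ring_scope.

Section distributions.
Context {R : realType}.

Definition cdf_of (F : probability R R) (x : R) : R :=
  fine (F `]-oo, x]%classic).

(* [inf] is a total function with default value 0; for 0 < p < 1 both sets
   below are nonempty and bounded from below, so it is the true infimum. *)
Definition QL (F : probability R R) (p : R) : R := inf [set x | p <= cdf_of F x].

Definition QR (F : probability R R) (p : R) : R := inf [set x | p < cdf_of F x].

(* [mu] is a bare set function so that image laws [pushforward F f] need not be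
   repackaged as probability measures. *)
Definition is_median (mu : set R -> \bar R) (m : R) : Prop :=
  ((2^-1)%:E <= mu `]-oo, m]%classic)%E /\ ((2^-1)%:E <= mu `[m, +oo[%classic)%E.

Definition has_unique_median (mu : set R -> \bar R) : Prop :=
  exists! m, is_median mu m.

Definition median (mu : set R -> \bar R) : R := get [set m | is_median mu m].

Definition m1 (F : probability R R) : R := median F.

Definition absdev_law (F : probability R R) : set R -> \bar R :=
  pushforward F (fun x : R => `|x - m1 F| : R).

Definition m2 (F : probability R R) : R := median (absdev_law F).

Definition absdev2_law (F : probability R R) : set R -> \bar R :=
  pushforward F (fun x : R => `| `|x - m1 F| - m2 F| : R).

Definition m4 (F : probability R R) : R := median (absdev2_law F).

Definition regular_region (tbar : R) (F : probability R R) : set R :=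
  `[QL F (2^-1 - tbar), QR F (2^-1 + tbar)]%classic `|`
  `[m1 F - 2 * m2 F, m1 F + 2 * m2 F]%classic.

(* [mad_gt0] makes explicit that the slope 1 / (B m2(F)) is meaningful; with
   the convention 0^-1 = 0 the slope condition would be void when m2(F) = 0. *)
Record mad_family (tbar B m2bar kappa : R) (F : probability R R) : Prop := {
  mad_unique_m1 : has_unique_median F ;
  mad_unique_m2 : has_unique_median (absdev_law F) ;
  mad_unique_m4 : has_unique_median (absdev2_law F) ;
  mad_gt0 : 0 < m2 F ;
  mad_slope : forall x1 x2 : R,
    regular_region tbar F x1 -> regular_region tbar F x2 ->
    1 / (B * m2 F) * `|x1 - x2| <= `|cdf_of F x1 - cdf_of F x2| ;
  mad_bounded : m2 F <= m2bar ;
  mad_m4 : m2 F <= kappa * m4 F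
}.

(* For a sequence of size n, the entries of the sorted sequence are indexed
   from 0: the middle one is n./2 for odd n, and n./2.-1, n./2 for even n. *)
Definition emp_median (s : seq R) : R :=
  let t := sort <=%R s in
  if odd (size s) then t`_(size s)./2
  else (t`_(size s)./2.-1 + t`_(size s)./2) / 2.

Definition emp_mad (s : seq R) : R :=
  emp_median [seq `|x - emp_median s| | x <- s].

End distributions.

Definition has_law d d' (T : measurableType d) (T' : measurableType d')
    (R : realType) (P : probability T R) (X : {RV P >-> T'})
    (mu : set T' -> \bar R) : Prop :=
  forall A : set T', measurable A -> distribution P X A = mu A.

Definition mutually_independent d (T : measurableType d) (R : realType)
    (P : probability T R) (I : finType) (G : I -> set (set T)) : Prop :=
  forall (J : {set I}) (A : I -> set T), (forall i, i \in J -> G i (A i)) ->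
    P (\bigcap_(i in [set i | i \in J]) A i) = (\prod_(i in J) P (A i))%E.

(* The events observable through X, i.e. the sigma-algebra generated by X. *)
Definition events_of d d' (T : measurableType d) (T' : measurableType d')
    (X : T -> T') : set (set T) := preimage_set_system setT X measurable.

(* Joint independence of all the variables Y_i and D_i taken together; the index
   type is a sum because the two families have different value types. *)
Definition independent_families d d1 d2 (T : measurableType d)
    (T1 : measurableType d1) (T2 : measurableType d2) (R : realType)
    (P : probability T R) (n : nat)
    (Y : 'I_n -> {RV P >-> T1}) (D : 'I_n -> {RV P >-> T2}) : Prop :=
  mutually_independent P (fun k : 'I_n + 'I_n =>
    match k with inl i => events_of (Y i) | inr i => events_of (D i) end).

Definition contaminated d (T : measurableType d) (R : realType)
    (P : probability T R) (n : nat) (Y Z : 'I_n -> {RV P >-> R})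
    (D : 'I_n -> {RV P >-> bool}) (i : 'I_n) (w : T) : R :=
  (1 - (D i w)%:R) * Y i w + (D i w)%:R * Z i w.

(* Main.v *)
Require Import Defs.
From HB Require Import structures.
From mathcomp Require Import all_boot all_order all_algebra.
From mathcomp Require Import all_classical all_reals all_analysis.
From mathcomp Require Import measurable_realfun ring lra zify.

(* As m4 <= m2, condition (iii) forces kappa >= 1. Put a = eps / (2 (1 - eps)),
   s = sqrt (2 ln (4 / delta) / n), r = a + s and c = B m2 r; the hypotheses give
   r <= 1 / B, hence c <= m2. The slope condition makes each of the four sets
   {x > m1 + c}, {x < m1 - 2 c}, {|x - m1| > m2 + c}, {|x - m1| < m2 - c}
   of F-mass at most 1/2 - r. A sample X_i falls into such a set A only if D_i = 1
   or Y_i is in A, an event of probability at most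
   eps + (1 - eps) (1/2 - r) = 1/2 - (1 - eps) s, so by Chernoff's bound the set A
   contains half of the sample with probability at most
   exp (- 2 n ((1 - eps) s)^2) <= delta / 4. When none of the four sets does, the
   empirical median is within 2 c of m1, hence the empirical MAD is within 3 c of
   m2, and 3 c <= (1 + 2 kappa) B m2 a + E. *)

Set Implicit Arguments.
Unset Strict Implicit.
Unset Printing Implicit Defensive.

Import Order.TTheory GRing.Theory Num.Theory.
Import numFieldNormedType.Exports.

Local Open Scope classical_set_scope.
Local Open Scope ring_scope.

(** * Counting criteria for the empirical median *)

Section EmpiricalMedian.
Context {R : realType}.
Implicit Types (s : seq R) (u l : R).

(** Entries at most [u] form a prefix of the sorted list longer than half of it, so this prefix
    covers both middle indices. *)
Lemma emp_median_le s u :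
  (2 * count (fun x => (u < x)%R) s < size s)%N -> emp_median s <= u.
Proof.
move=> hc; rewrite /emp_median.
set t := sort _ _.
have ts : sorted <=%R t by apply: sort_le_sorted.
have st : size t = size s by rewrite size_sort.
have ct : count (<= u) t = (size s - count (fun x => (u < x)%R) s)%N.
  by rewrite count_le_gt st; congr (_ - _)%N; apply/permP; rewrite perm_sort.
have nthu k : (k <= (size s)./2)%N -> t`_k <= u.
  move=> kn; apply: nth_count_le => //.
  rewrite ct; lia.
case: ifP => _; first exact: nthu.
have := nthu (size s)./2.-1 (leq_pred _); have := nthu _ (leqnn (size s)./2).
by lra.
Qed.

Lemma emp_median_ge s l :
  (2 * count (fun x => (x < l)%R) s < size s)%N -> l <= emp_median s.
Proof.
move=> hc; rewrite /emp_median.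
set t := sort _ _.
have ts : sorted <=%R t by apply: sort_le_sorted.
have st : size t = size s by rewrite size_sort.
have ct : count (< l) t = count (fun x => (x < l)%R) s.
  by apply/permP; rewrite perm_sort.
have nthl k : (count (fun x => (x < l)%R) s <= k < size s)%N -> l <= t`_k.
  by move=> kn; apply: nth_count_ge; rewrite ?ct ?st.
case: ifP => od; first by apply: nthl; lia.
(* For even size the strict hypothesis bounds the count by [(size s)./2.-1], so even the lower
   middle entry lies past the entries below [l]. *)
have h1 : l <= t`_(size s)./2.-1 by apply: nthl; lia.
have h2 : l <= t`_(size s)./2 by apply: nthl; lia.
by lra.
Qed.

End EmpiricalMedian.

(** * A Chernoff bound on a finite product space *)

(* Weighting each index by x or 1/x according to [a], with x the optimal Chernoff
   parameter for the success probability 1/2 - g, avoids expectations altogether. *)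
Lemma chernoff_half {R : realType} (K : finType) (n : nat) (w : K -> R)
    (a : pred K) (g : R) :
  (forall k, 0 <= w k) -> \sum_k w k = 1 -> 0 <= g < 2^-1 ->
  \sum_(k | a k) w k <= 2^-1 - g ->
  \sum_(f : {ffun 'I_n -> K} | (n <= 2 * #|[pred i | a (f i)]|)%N)
     \prod_i w (f i) <= expR (- (2 * g ^+ 2) * n%:R).
Proof.
move=> w0 w1 /andP[g0 g2] wa.
(* The ratio [sq / sp] minimises [(2^-1 - g) * x + (2^-1 + g) / x], with minimum [2 * sp * sq]. *)
pose sp : R := Num.sqrt (2^-1 - g); pose sq : R := Num.sqrt (2^-1 + g).
have sp0 : 0 < sp by rewrite sqrtr_gt0; lra.
have sq0 : 0 < sq by rewrite sqrtr_gt0; lra.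
have spE : sp ^+ 2 = 2^-1 - g by rewrite sqr_sqrtr//; lra.
have sqE : sq ^+ 2 = 2^-1 + g by rewrite sqr_sqrtr//; lra.
have spq : sp <= sq by rewrite ler_wsqrtr//; lra.
pose x : R := sq / sp.
have x1 : 1 <= x by rewrite ler_pdivlMr// mul1r.
have x0 : 0 < x by apply: lt_le_trans x1.
have xV : x^-1 <= x by rewrite (le_trans _ x1)// invf_le1.
pose phi k := if a k then x else x^-1.
have phi0 k : 0 <= phi k by rewrite /phi; case: ifP; rewrite ?invr_ge0 ltW.
(* On the event the product has at least as many factors [x] as [x^-1], and [1 <= x]. *)
have phiM (f : {ffun 'I_n -> K}) : (n <= 2 * #|[pred i | a (f i)]|)%N ->
    1 <= \prod_i phi (f i).
  move=> hf; rewrite (bigID (fun i => a (f i)))/=.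
  rewrite (eq_bigr (fun=> x)); last by move=> i; rewrite /phi => ->.
  rewrite (eq_bigr (fun=> x^-1) (P := fun i => ~~ a (f i))); last first.
    by move=> i; rewrite /phi => /negbTE ->.
  rewrite !big_const !iter_mulr_1 exprVn -ler_pdivrMr ?exprn_gt0 ?invr_gt0 ?exprn_gt0//.
  rewrite invrK mul1r; apply: ler_weXn2l => //.
  have cc : (#|[pred i | a (f i)]| + #|(fun i => ~~ a (f i))| = n)%N.
    by rewrite -[RHS]card_ord -(cardC [pred i | a (f i)]).
  have half (p q m : nat) : (p + q = m -> m <= 2 * p -> q <= p)%N by lia.
  exact: half cc hf.
(* Markov's argument: the inserted weights have product at least 1 on the event, so the sum may be
   extended to all [f], where it factorises. *)
apply: (@le_trans _ _ (\sum_(f : {ffun 'I_n -> K}) \prod_i (w (f i) * phi (f i)))).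
  rewrite big_mkcond/=; apply: ler_sum => f _.
  case: ifP => hf; last by apply: prodr_ge0 => i _; rewrite mulr_ge0.
  rewrite big_split/= -[leLHS]mulr1 ler_wpM2l ?phiM//.
  by apply: prodr_ge0.
rewrite -(bigA_distr_bigA (fun (_ : 'I_n) k => w k * phi k))/=.
rewrite prodr_const card_ord mulrC expRM_natl.
have sum0 : 0 <= \sum_k w k * phi k by apply: sumr_ge0 => k _; rewrite mulr_ge0.
rewrite lerXn2r ?nnegrE ?expR_ge0//.
apply: (@le_trans _ _ (2 * sp * sq)).
  rewrite (bigID a)/=.
  rewrite (eq_bigr (fun k => w k * x)); last by move=> k; rewrite /phi => ->.
  rewrite (eq_bigr (fun k => w k * x^-1) (P := fun i => ~~ a i)); last first.
    by move=> k; rewrite /phi => /negbTE ->.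
  rewrite -!mulr_suml.
  have -> : \sum_(k | ~~ a k) w k = 1 - \sum_(k | a k) w k.
    by rewrite -w1 [in RHS](bigID a)/= addrAC subrr add0r.
  set S := \sum_(k | a k) w k in wa *.
  (* The sum is affine in [S] with slope [x - x^-1 >= 0], hence largest at [S = 2^-1 - g]. *)
  apply: (@le_trans _ _ ((2^-1 - g) * x + (2^-1 + g) * x^-1)).
    have : 0 <= (2^-1 - g - S) * (x - x^-1) by rewrite mulr_ge0 ?subr_ge0.
    by lra.
  rewrite -spE -sqE /x le_eqVlt; apply/orP; left; apply/eqP; field.
  by rewrite !lt0r_neq0.
have spq0 : 0 <= 2 * sp * sq by rewrite !mulr_ge0// ltW.
(* Squaring removes the roots and leaves [1 - 4 * g ^+ 2 <= expR (- (4 * g ^+ 2))]. *)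
rewrite -(@ler_pXn2r _ 2)// ?nnegrE ?expR_ge0//.
rewrite -expRM_natl !exprMn spE sqE.
apply: le_trans (expR_ge1Dx _); rewrite le_eqVlt; apply/orP; left; apply/eqP.
by field.
Qed.

(** * Events decided by finitely many finite-valued variables *)

Lemma measure_bigsetU_le d (T : measurableType d) (R : realType)
    (mu : {measure set T -> \bar R}) (I : Type) (r : seq I) (Q : pred I)
    (A : I -> set T) :
  (forall i, measurable (A i)) ->
  (mu (\big[setU/set0]_(i <- r | Q i) A i) <= \sum_(i <- r | Q i) mu (A i))%E.
Proof.
move=> mA; elim: r => [|i r IHr]; first by rewrite !big_nil measure0.
rewrite !big_cons; case: ifP => // _.
apply: le_trans; first by apply: measureU2 => //; exact: bigsetU_measurable.
exact: leeD2l.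
Qed.

Section FinitePatterns.
Context {d} {T : measurableType d} {n : nat} {K : finType}.
Variables (V : 'I_n -> T -> K) (Q : pred {ffun 'I_n -> K}).

Lemma pattern_eventE :
  [set w | Q [ffun i => V i w]] =
  \big[setU/set0]_(f : {ffun 'I_n -> K} | Q f)
    \bigcap_(i in [set: 'I_n]) [set w | V i w = f i].
Proof.
rewrite -(bigcup_pred Q); apply/seteqP; split => [w Qw|w [f Qf wf]] /=.
  by exists [ffun i => V i w] => // i _ /=; rewrite ffunE.
suff -> : [ffun i => V i w] = f by [].
by apply/ffunP => i; rewrite ffunE; apply: wf.
Qed.

Hypothesis mV : forall i k, measurable [set w | V i w = k].

Lemma measurable_atom (f : 'I_n -> K) :
  measurable (\bigcap_(i in [set: 'I_n]) [set w | V i w = f i]).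
Proof. by apply: fin_bigcap_measurable => //; exact: finite_finset. Qed.

Lemma measurable_pattern_event : measurable [set w | Q [ffun i => V i w]].
Proof.
by rewrite pattern_eventE; apply: bigsetU_measurable => f _; exact: measurable_atom.
Qed.

End FinitePatterns.

(** * Measurability of order statistics and of the empirical MAD *)

Lemma count_map_enum (I : finType) (U : Type) (p : pred U) (f : I -> U) :
  count p [seq f i | i <- enum I] = #|[pred i | p (f i)]|.
Proof. by rewrite count_map cardE [in RHS]/enum_mem size_filter -enumT. Qed.

(** The entry of index [k] exceeds [x] exactly when at most [k] entries are at most [x], a condition
    on a finite boolean pattern. *)
Lemma measurable_order_statistic d (T : measurableType d) (R : realType)
    (n k : nat) (f : 'I_n -> T -> R) :
  (forall i, measurable_fun setT (f i)) ->
  measurable_fun setT (fun w => (sort <=%R [seq f i w | i <- enum 'I_n])`_k).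
Proof.
(* Past the end of the list the entry is the default 0, a constant function. *)
move=> mf; have [nk|kn] := leqP n k.
  rewrite (_ : (fun _ => _) = cst 0); first exact: measurable_cst.
  by apply/funext => w; rewrite nth_default// size_sort size_map size_enum_ord.
apply: (measurability _ (RGenOInfty.measurableE R)) => _ [_ [x ->] <-].
rewrite setTI.
pose Q (h : {ffun 'I_n -> bool}) := (#|[pred i | h i]| <= k)%N.
have QE w : Q [ffun i => (f i w <= x)%R] =
    (count (<= x)%R (sort <=%R [seq f i w | i <- enum 'I_n]) <= k)%N.
  rewrite /Q (permP (permEl (perm_sort _ _))) count_map_enum; congr (_ <= _)%N.
  by apply: eq_card => i; rewrite !inE ffunE.
rewrite [X in measurable X](_ : _ =
    [set w | Q [ffun i => (f i w <= x)%R]]); last first.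
  apply/seteqP; split => w /=; rewrite in_itv/= andbT QE.
    by rewrite leqNgt; apply: contraTN => kc; rewrite -leNgt nth_count_le// sort_le_sorted.
  move=> ck; apply: nth_count_gt; first exact: sort_le_sorted.
  by rewrite ck size_sort size_map size_enum_ord.
apply: measurable_pattern_event => i b.
have mb : measurable_fun setT (fun w => f i w <= x).
  by apply: measurable_fun_ler => //; exact: measurable_cst.
by have := mb measurableT [set b] I; rewrite setTI.
Qed.

Lemma measurable_emp_median d (T : measurableType d) (R : realType)
    (n : nat) (f : 'I_n -> T -> R) :
  (forall i, measurable_fun setT (f i)) ->
  measurable_fun setT (fun w => emp_median [seq f i w | i <- enum 'I_n]).
Proof.
move=> mf; rewrite /emp_median.
under eq_fun do rewrite size_map size_enum_ord.
case: (odd n); first exact: measurable_order_statistic.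
apply: measurable_funM; last exact: measurable_cst.
by apply: measurable_funD; exact: measurable_order_statistic.
Qed.

Lemma measurable_emp_mad d (T : measurableType d) (R : realType)
    (n : nat) (f : 'I_n -> T -> R) :
  (forall i, measurable_fun setT (f i)) ->
  measurable_fun setT (fun w => emp_mad [seq f i w | i <- enum 'I_n]).
Proof.
move=> mf; rewrite /emp_mad; under eq_fun do rewrite -map_comp.
apply: measurable_emp_median => i /=.
apply: measurableT_comp => //; apply: measurable_funB => //.
exact: measurable_emp_median.
Qed.

(** * Tail bound for the contaminated sample *)

Section Contamination.
Context {d d1} {T : measurableType d} {T1 : measurableType d1} {R : realType}.
Context {P : probability T R} {n : nat}.
Variables (Y : 'I_n -> {RV P >-> T1}) (D : 'I_n -> {RV P >-> bool}).
Variables (F : probability T1 R) (eps : R).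
Hypotheses (eps01 : 0 <= eps <= 1).
Hypotheses (hY : forall i, has_law (Y i) F).
Hypotheses (hD : forall i, has_law (D i) (bernoulli_prob eps)).
Hypothesis hindep : independent_families Y D.

Lemma independent_atom (B : 'I_n -> set T1) (C : 'I_n -> set bool) :
  (forall i, measurable (B i)) ->
  P (\bigcap_(i in [set: 'I_n]) (D i @^-1` C i `&` Y i @^-1` B i)) =
  (\prod_i (bernoulli_prob eps (C i) * F (B i)))%E.
Proof.
move=> mB.
pose A k := match k with inl i => Y i @^-1` B i | inr i => D i @^-1` C i end.
have := hindep (J := [set: 'I_n + 'I_n]%SET) (A := A).
rewrite (_ : \bigcap_(i in _) A i =
  \bigcap_(i in [set: 'I_n]) (D i @^-1` C i `&` Y i @^-1` B i)); last first.
  apply/seteqP; split => [w wA i _|w wA [i|i] _ /=].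
  - by split; [apply: (wA (inr i))|apply: (wA (inl i))]; rewrite /= inE.
  - by have [] := wA i I.
  - by have [] := wA i I.
move=> ->; last first.
  by case=> i _ /=; [exists (B i)|exists (C i)] => //; rewrite setTI.
under eq_bigl do rewrite inE.
rewrite big_sumType/= -big_split/=; apply: eq_bigr => i _.
by rewrite muleC; congr (_ * _)%E; [exact: hD|exact: hY].
Qed.

Variable a : T1 -> bool.
Hypothesis ma : measurable_fun setT a.

(** Two bits per sample suffice for the count, which brings the problem to the finite setting of
    [chernoff_half]. *)
Let V i w := (D i w, a (Y i w)).

Let patternE i k : [set w | V i w = k] =
  D i @^-1` [set k.1] `&` Y i @^-1` [set y | a y = k.2].
Proof.
by apply/seteqP; split => w; rewrite /V; [move=> /= <-|case: k => ? ? /= [-> ->]].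
Qed.

Let measurable_level b : measurable [set y | a y = b].
Proof. by rewrite -[X in measurable X]setTI; exact: (@ma measurableT [set b]). Qed.

Let measurable_V i k : measurable [set w | V i w = k].
Proof.
by rewrite patternE; apply: measurableI; rewrite -[_ @^-1` _]setTI; exact: measurable_funP.
Qed.

Let Q (f : {ffun 'I_n -> bool * bool}) :=
  (n <= 2 * #|[pred i | (f i).1 || (f i).2]|)%N.

Let countE : [set w | (n <= 2 * #|[pred i | D i w || a (Y i w)]|)%N] =
  [set w | Q [ffun i => V i w]].
Proof.
apply/funext => w /=; congr (is_true (_ <= 2 * _)%N).
by apply: eq_card => i; rewrite !inE ffunE.
Qed.

Lemma measurable_contaminated_count :
  measurable [set w | (n <= 2 * #|[pred i | D i w || a (Y i w)]|)%N].
Proof. by rewrite countE; exact: measurable_pattern_event. Qed.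

(** Counting [D i w || a (Y i w)] treats every corrupted sample as bad, so the arbitrary [Z]
    disappears and the counted events are independent, each of the probability bounded in the second
    hypothesis. *)
Lemma contaminated_count_tail (g : R) : 0 <= g < 2^-1 ->
  eps + (1 - eps) * fine (F [set y | a y]) <= 2^-1 - g ->
  (P [set w | (n <= 2 * #|[pred i | D i w || a (Y i w)]|)%N] <=
   (expR (- (2 * g ^+ 2) * n%:R))%:E)%E.
Proof.
move=> g0 pg.
pose W (k : bool * bool) := k.1 || k.2.
(* The common law of the pairs [V i]; by independence, atoms have product weights. *)
pose p (k : bool * bool) : R :=
  (if k.1 then eps else 1 - eps) *
  (if k.2 then fine (F [set y | a y]) else 1 - fine (F [set y | a y])).
have Ffin : F [set y | a y] \is a fin_num.
  by apply: fin_num_measure; exact: (measurable_level true).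
have [F0 F1] : 0 <= fine (F [set y | a y]) /\ fine (F [set y | a y]) <= 1.
  rewrite fine_ge0 ?measure_ge0// -lee_fin fineK//; split => //.
  by apply: probability_le1; exact: (measurable_level true).
have atom (f : {ffun 'I_n -> bool * bool}) :
    P (\bigcap_(i in [set: 'I_n]) [set w | V i w = f i]) = (\prod_i p (f i))%:E.
  rewrite (eq_bigcapr (fun i _ => patternE i (f i))) independent_atom//.
  rewrite -prodEFin; apply: eq_bigr => i _; rewrite EFinM; congr (_ * _)%E.
    rewrite bernoulli_probE//= !diracE; case: (f i).1.
      by rewrite mem_set// memNset// mule1 mule0 adde0.
    by rewrite memNset// mem_set// mule1 mule0 add0e.
  case: (f i).2 => /=; first by rewrite fineK.
  rewrite (_ : [set y | a y = false] = ~` [set y | a y = true]); last first.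
    by apply/seteqP; split => [y /= ->|y /= /negP/negbTE].
  by rewrite probability_setC//= EFinB fineK.
rewrite countE pattern_eventE.
apply: le_trans; first by apply: measure_bigsetU_le => f; exact: measurable_atom.
rewrite (eq_bigr _ (fun f _ => atom f)) sumEFin lee_fin.
case/andP: eps01 => e0 e1; apply: (@chernoff_half _ _ _ _ W) => //.
- by move=> [b c]; rewrite /p/=; apply: mulr_ge0; [case: b|case: c]; lra.
- rewrite (eq_bigr (fun k => p (k.1, k.2))); last by case.
  by rewrite -(pair_bigA _ (fun b c => p (b, c)))/= !big_bool/= /p/=; lra.
- rewrite big_mkcond (eq_bigr (fun k => if W (k.1,k.2) then p (k.1, k.2) else 0)); last by case.
  rewrite -(pair_bigA _ (fun b c => if W (b,c) then p (b, c) else 0))/= !big_bool/=.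
  by rewrite /p/=; lra.
Qed.

End Contamination.

(** * From sample counts to the error of the empirical MAD *)

(** Recentring from [m] to the empirical median moves each deviation by at most [2 * c], so a
    deviation more than [3 * c] away from [v] was already more than [c] away, on the same side,
    before recentring. *)
Lemma emp_mad_dist (R : realType) (s : seq R) (m v c : R) :
  (2 * count (fun x => (m + c < x)%R) s < size s)%N ->
  (2 * count (fun x => (x < m - 2 * c)%R) s < size s)%N ->
  (2 * count (fun x => (v + c < `|x - m|)%R) s < size s)%N ->
  (2 * count (fun x => (`|x - m| < v - c)%R) s < size s)%N ->
  0 <= c -> `|emp_mad s - v| <= 3 * c.
Proof.
move=> /emp_median_le mu /emp_median_ge ml hu hl c0.
have mc : `|emp_median s - m| <= 2 * c by rewrite ler_norml; lra.
suff: v - 3 * c <= emp_mad s <= v + 3 * c by rewrite ler_norml; lra.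
apply/andP; split.
  apply: emp_median_ge; rewrite size_map count_map.
  apply: leq_ltn_trans hl; rewrite leq_mul2l/=; apply: sub_count => x /= xl.
  by have := ler_distD (emp_median s) x m; lra.
apply: emp_median_le; rewrite size_map count_map.
apply: leq_ltn_trans hu; rewrite leq_mul2l/=; apply: sub_count => x /= xu.
have := ler_distD m x (emp_median s); rewrite (distrC m); lra.
Qed.

Lemma measurable_bool_set d (T : measurableType d) (a : T -> bool) :
  measurable_fun setT a -> measurable [set x | a x].
Proof. by move=> ma; have := ma measurableT [set true] I; rewrite setTI. Qed.

Lemma measurable_absdev (R : realType) (m : R) :
  measurable_fun setT (fun x : R => `|x - m|).
Proof. by apply: measurableT_comp => //; exact: measurable_funB. Qed.

(** * Population medians and mass bounds *)

Section Medians.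
Context {R : realType}.

Lemma median_is_median (mu : set R -> \bar R) :
  has_unique_median mu -> is_median mu (median mu).
Proof. by move=> [m [mm _]]; apply: (@getPex _ [set m | is_median mu m]); exists m. Qed.

Lemma median_unique (mu : set R -> \bar R) (m : R) :
  has_unique_median mu -> is_median mu m -> median mu = m.
Proof.
move=> uq mm; have := median_is_median uq.
by case: uq => m' [_ uq] /uq <-; rewrite (uq _ mm).
Qed.

Variable F : probability R R.

(** If [m2 F < m4 F], then [m2 F] would be a second median of [absdev2_law F]: the second deviation
    is at most [m2 F] wherever the first one is. *)
Lemma m4_le_m2 : has_unique_median (absdev_law F) ->
  has_unique_median (absdev2_law F) -> m4 F <= m2 F.
Proof.
move=> u2 u4; rewrite leNgt; apply/negP => m24.
have mf := measurable_absdev (m1 F).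
have mg : measurable_fun setT (fun x : R => `| `|x - m1 F| - m2 F| : R).
  by apply: measurableT_comp => //; exact: measurable_funB.
have mpre (h : R -> R) (A : set R) : measurable_fun setT h -> measurable A ->
    measurable (h @^-1` A).
  by move=> mh mA; rewrite -[_ @^-1` _]setTI; exact: mh.
have [lo2 _] := median_is_median u2; have [_ hi4] := median_is_median u4.
suff /(median_unique u4) m42 : is_median (absdev2_law F) (m2 F).
  by move: m24; rewrite -m42 /m4 ltxx.
split.
  apply: (le_trans lo2); rewrite -/(m2 F) /absdev_law /absdev2_law /pushforward.
  apply: le_measure; rewrite ?inE; [exact: mpre|exact: mpre|].
  move=> x /=; rewrite !in_itv/= => h; have := normr_ge0 (x - m1 F).
  by rewrite ler_norml; lra.
apply: (le_trans hi4); rewrite -/(m4 F) /absdev2_law /pushforward.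
apply: le_measure; rewrite ?inE; [exact: mpre|exact: mpre|].
by move=> x /=; rewrite !in_itv/= !andbT; apply: le_trans; exact: ltW.
Qed.

Lemma fine_probabilityU (A B : set R) : measurable A -> measurable B ->
  A `&` B = set0 -> fine (F (A `|` B)) = fine (F A) + fine (F B).
Proof. by move=> mA mB AB; rewrite measureU// fineD ?fin_num_measure. Qed.

Lemma fine_probability_itv (x y : R) : x <= y ->
  fine (F `]x, y]%classic) = cdf_of F y - cdf_of F x.
Proof.
move=> xy; rewrite /cdf_of.
rewrite (_ : `]-oo, y]%classic = `]-oo, x]%classic `|` `]x, y]%classic); last first.
  by rewrite -itv_bndbnd_setU.
rewrite fine_probabilityU//; first by rewrite addrAC subrr add0r.
apply/seteqP; split => // z /=; rewrite !in_itv/= => -[? /andP[]]; lra.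
Qed.

(** Common scheme of the four mass bounds: [B] is a half-mass set given by a median, and [C] a gap
    of mass at least [r] separating it from [A]. *)
Lemma fine_probability_le (A B C : set R) (r : R) :
  measurable A -> measurable B -> measurable C ->
  A `<=` ~` B -> A `<=` ~` C -> B `<=` ~` C ->
  ((2^-1)%:E <= F B)%E -> r <= fine (F C) -> fine (F A) <= 2^-1 - r.
Proof.
move=> mA mB mC AB AC BC hB hC.
have hB' : 2^-1 <= fine (F B) by rewrite -lee_fin fineK// fin_num_measure.
have mAB : measurable (A `|` B) by exact: measurableU.
have : fine (F (A `|` B `|` C)) <= 1.
  have mABC : measurable (A `|` B `|` C) by exact: measurableU.
  by rewrite -lee_fin fineK ?fin_num_measure//; exact: probability_le1.
rewrite fine_probabilityU//; last first.
  by apply/seteqP; split => // z [[/AC|/BC]].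
rewrite fine_probabilityU//; last by apply/seteqP; split => // z [/AB].
by lra.
Qed.

Section Family.
Variables tbar B m2bar kappa : R.
Hypotheses (B0 : 0 < B) (hF : mad_family tbar B m2bar kappa F).

Lemma mad_kappa_ge1 : 0 <= kappa -> 1 <= kappa.
Proof.
move=> kappa0; have m0 := mad_gt0 hF; have := mad_m4 hF.
have := m4_le_m2 (mad_unique_m2 hF) (mad_unique_m4 hF) => m42 mk.
rewrite leNgt; apply/negP => k1.
have : kappa * m4 F <= kappa * m2 F by rewrite ler_wpM2l.
have : kappa * m2 F < 1 * m2 F by rewrite ltr_pM2r.
by lra.
Qed.

Variable r : R.
Hypotheses (r0 : 0 < r) (rB : r <= 1 / B).
(** The length over which the slope condition guarantees mass [r]. *)
Let c := B * m2 F * r.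

Lemma mad_step_gt0 : 0 < c.
Proof. by rewrite !mulr_gt0// (mad_gt0 hF). Qed.

(** Keeps the gap intervals used below within distance [2 * m2 F] of [m1 F]. *)
Lemma mad_step_le : c <= m2 F.
Proof.
have m0 := mad_gt0 hF.
by move: rB; rewrite ler_pdivlMr// /c mulrAC (mulrC r) => rB1; rewrite ler_piMl// ltW.
Qed.

(** Half-open intervals have mass exactly a cdf increment, even with atoms; both endpoints lie in
    the second interval of [regular_region]. *)
Lemma mad_step_mass (x : R) : m1 F - 2 * m2 F <= x <= m1 F + 2 * m2 F - c ->
  r <= fine (F `]x, x + c]%classic).
Proof.
have c0 := mad_step_gt0; have m0 := mad_gt0 hF.
move=> /andP[xl xu]; rewrite fine_probability_itv; last by lra.
have xc : cdf_of F x <= cdf_of F (x + c).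
  apply: fine_le; rewrite ?fin_num_measure//.
  by apply: le_measure; rewrite ?inE//; apply: subitvPr; rewrite bnd_simp; lra.
rewrite -[leRHS]ger0_norm ?subr_ge0//.
apply: le_trans (mad_slope hF _ _); last 2 first.
- by right; rewrite /= in_itv/=; lra.
- by right; rewrite /= in_itv/=; lra.
rewrite addrAC subrr add0r (ger0_norm (ltW c0)).
have -> : 1 / (B * m2 F) * c = r by rewrite /c; field; rewrite !lt0r_neq0.
exact: lexx.
Qed.

Lemma mass_gt_m1 : fine (F [set x | m1 F + c < x]) <= 2^-1 - r.
Proof.
have c0 := mad_step_gt0; have cm := mad_step_le; have m0 := mad_gt0 hF.
have [lo _] := median_is_median (mad_unique_m1 hF).
apply: (@fine_probability_le _ `]-oo, m1 F]%classic `]m1 F, m1 F + c]%classic) => //.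
- by apply: measurable_bool_set; exact: measurable_fun_ltr.
- by move=> x /=; rewrite in_itv/=; lra.
- by move=> x /=; rewrite in_itv/=; lra.
- by move=> x /=; rewrite !in_itv/=; lra.
- by apply: mad_step_mass; lra.
Qed.

(* The offset is 2 c rather than c because ]m1 - c, m1] may share an atom of F at
   m1 with [m1, +oo[, whereas the interval ]m1 - 2 c, m1 - c] does not. *)
Lemma mass_lt_m1 : fine (F [set x | x < m1 F - 2 * c]) <= 2^-1 - r.
Proof.
have c0 := mad_step_gt0; have cm := mad_step_le; have m0 := mad_gt0 hF.
have [_ hi] := median_is_median (mad_unique_m1 hF).
apply: (@fine_probability_le _ `[m1 F, +oo[%classic
  `]m1 F - 2 * c, m1 F - 2 * c + c]%classic) => //.
- by apply: measurable_bool_set; exact: measurable_fun_ltr.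
- by move=> x /=; rewrite in_itv/=; lra.
- by move=> x /=; rewrite in_itv/=; lra.
- by move=> x /=; rewrite !in_itv/=; lra.
- by apply: mad_step_mass; lra.
Qed.

Lemma mass_absdev_gt : fine (F [set x | m2 F + c < `|x - m1 F|]) <= 2^-1 - r.
Proof.
have c0 := mad_step_gt0; have cm := mad_step_le; have m0 := mad_gt0 hF.
have [lo _] := median_is_median (mad_unique_m2 hF).
apply: (@fine_probability_le _ [set x | `|x - m1 F| <= m2 F]
  `]m1 F + m2 F, m1 F + m2 F + c]%classic) => //.
- by apply: measurable_bool_set; apply: measurable_fun_ltr => //; exact: measurable_absdev.
- by apply: measurable_bool_set; apply: measurable_fun_ler => //; exact: measurable_absdev.
- by move=> x /=; lra.
- by move=> x /=; rewrite in_itv/= => h /andP[h1 h2]; move: h; rewrite ger0_norm; lra.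
- by move=> x /=; rewrite in_itv/= ler_norml; lra.
- by apply: mad_step_mass; lra.
Qed.

(** The gap is taken to the left of [m1 F], where its open end excludes deviation exactly [m2 F]; a
    half-open gap to the right would contain the possible atom at [m1 F + m2 F]. *)
Lemma mass_absdev_lt : fine (F [set x | `|x - m1 F| < m2 F - c]) <= 2^-1 - r.
Proof.
have c0 := mad_step_gt0; have cm := mad_step_le; have m0 := mad_gt0 hF.
have [_ hi] := median_is_median (mad_unique_m2 hF).
apply: (@fine_probability_le _ [set x | m2 F <= `|x - m1 F|]
  `]m1 F - m2 F, m1 F - m2 F + c]%classic) => //.
- by apply: measurable_bool_set; apply: measurable_fun_ltr => //; exact: measurable_absdev.
- by apply: measurable_bool_set; apply: measurable_fun_ler => //; exact: measurable_absdev.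
- by move=> x /=; lra.
- by move=> x /=; rewrite in_itv/= ltr_norml; lra.
- by move=> x /=; rewrite in_itv/= => h /andP[h1 h2]; move: h; rewrite ler0_norm; lra.
- by move: hi; rewrite -/(m2 F) /absdev_law /pushforward preimage_itvcy.
- by apply: mad_step_mass; lra.
Qed.

End Family.
End Medians.

(** * Choice of constants and union bound *)

Theorem lemma19 (R : realType) (tbar B m2bar kappa eps : R)
    (htbar : 0 < tbar < 2^-1) (hB : 0 < B) (hm2bar : 0 < m2bar)
    (hkappa : 0 <= kappa)
    (heps : 0 < eps < Num.min (2 * tbar / (1 + 2 * tbar)) (1 / B))
    (F : probability R R) (hF : mad_family tbar B m2bar kappa F)
    (d : measure_display) (T : measurableType d) (P : probability T R)
    (n : nat) (Y Z : 'I_n -> {RV P >-> R}) (D : 'I_n -> {RV P >-> bool})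
    (hY : forall i, has_law (Y i) F)
    (hD : forall i, has_law (D i) (bernoulli_prob eps))
    (hindep : independent_families Y D)
    (delta E : R) (hdelta : 0 < delta) (hE : 0 < E)
    (hn : 2 * Num.max (16 * kappa ^+ 2 * B ^+ 2 * m2bar ^+ 2 / E ^+ 2)
                ((Num.min tbar (1 / B) - eps / (2 * (1 - eps))) ^- 2)
            * ln (4 / delta) <= n%:R) :
  ((1 - delta)%:E <=
   P [set w | (`|emp_mad [seq contaminated Y Z D i w | i <- enum 'I_n] - m2 F|
              <= (1 + 2 * kappa) * B * m2 F * (eps / (2 * (1 - eps))) + E)%R])%E.
Proof.
have [d1|d1] := leP 1 delta.
  by apply: (@le_trans _ _ 0%E) => //; rewrite lee_fin subr_le0.
case/andP: htbar => t0 t12; case/andP: heps => e0; rewrite lt_min => /andP[et eB].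
set a := eps / (2 * (1 - eps)); set L := ln (4 / delta) in hn *.
set gap := Num.min tbar (1 / B) - a in hn.
have e2 : eps < 2^-1 by move: et; rewrite ltr_pdivlMr; nra.
(* Equivalently [eps + (1 - eps) * (2^-1 - a) = 2^-1]: the margin [a] exactly absorbs the
   contamination. *)
have a_eq : (1 - eps) * a = eps / 2.
  by rewrite /a; field; rewrite lt0r_neq0//; lra.
have a0 : 0 < a by rewrite /a divr_gt0//; lra.
have ae : a < eps by rewrite /a ltr_pdivrMr; nra.
have at_ : a < tbar.
  move: et; rewrite ltr_pdivlMr; last by lra.
  by rewrite /a ltr_pdivrMr; nra.
clearbody a.
have gap0 : 0 < gap by rewrite subr_gt0 lt_min at_ (lt_trans ae).
have L0 : 0 < L by rewrite ln_gt0// ltr_pdivlMr//; lra.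
have m0 := mad_gt0 hF; have mb := mad_bounded hF.
have k1 := mad_kappa_ge1 hF hkappa.
have N0 : 0 < n%:R :> R.
  apply: lt_le_trans hn; rewrite !mulr_gt0// lt_max; apply/orP; right.
  by rewrite invr_gt0 exprn_gt0.
(* With this [s] the Chernoff exponent for [g = (1 - eps) * s] is [4 * (1 - eps) ^+ 2 * L], at least
   [L] since [eps < 2^-1]. *)
pose s : R := Num.sqrt (2 * L / n%:R).
have s0 : 0 < s by rewrite sqrtr_gt0 divr_gt0// mulr_gt0.
have s2 : s ^+ 2 * n%:R = 2 * L.
  rewrite sqr_sqrtr; last by rewrite ltW// divr_gt0// mulr_gt0.
  by field; rewrite lt0r_neq0.
(* Turns each term of the maximum in [hn] into a bound on [s]: once with [gap], once with [E]. *)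
have s_small (q y : R) : 0 < y -> 0 <= q -> 2 * (q ^+ 2 / y ^+ 2) * L <= n%:R -> q * s <= y.
  move=> y0 q0 h.
  rewrite -(@ler_pXn2r _ 2)// ?nnegrE ?mulr_ge0 ?(ltW y0) ?(ltW s0)//.
  rewrite exprMn -(ler_pM2r N0) -mulrA s2.
  have -> : q ^+ 2 * (2 * L) = y ^+ 2 * (2 * (q ^+ 2 / y ^+ 2) * L).
    by field; rewrite lt0r_neq0.
  by rewrite ler_pM2l// exprn_gt0.
have hn_max x : x <= Num.max (16 * kappa ^+ 2 * B ^+ 2 * m2bar ^+ 2 / E ^+ 2) (gap ^- 2) ->
    2 * x * L <= n%:R.
  by move=> hx; apply: le_trans hn; rewrite ler_pM2r// ler_pM2l.
have sgap : s <= gap.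
  rewrite -[s]mul1r; apply: s_small => //; apply: hn_max.
  by rewrite expr1n div1r le_max lexx orbT.
have sE : 4 * kappa * B * m2bar * s <= E.
  apply: s_small => //; first by rewrite !mulr_ge0// ltW.
  apply: hn_max; rewrite le_max; apply/orP; left.
  rewrite le_eqVlt; apply/orP; left; apply/eqP.
  by congr (_ / _); ring.
pose r := a + s.
have r0 : 0 < r by rewrite addr_gt0.
have : r <= Num.min tbar (1 / B) by rewrite /r addrC -lerBrDr.
rewrite le_min => /andP[rt rB].
set c := B * m2 F * r.
have c0 : 0 < c by rewrite !mulr_gt0.
(* Both [3 <= 1 + 2 * kappa] (for the [a] part) and [3 <= 4 * kappa] (for the [s] part) follow from
   [1 <= kappa]. *)
have cE : 3 * c <= (1 + 2 * kappa) * B * m2 F * a + E.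
  have : B * m2 F * s * 3 <= 4 * kappa * B * m2bar * s.
    have -> : 4 * kappa * B * m2bar * s = B * m2bar * s * (4 * kappa) by ring.
    apply: ler_pM; rewrite ?mulr_ge0 ?(ltW B0)//; try lra.
    by rewrite ler_pM2r// ler_pM2l.
  have : B * m2 F * a * 3 <= B * m2 F * a * (1 + 2 * kappa).
    by rewrite ler_pM2l ?mulr_gt0//; lra.
  rewrite /c /r; lra.
pose bad (p : R -> bool) := [set w | (n <= 2 * #|[pred i | D i w || p (Y i w)]|)%N].
have eps01 : 0 <= eps <= 1 by lra.
have tail (p : R -> bool) : measurable_fun setT p ->
    fine (F [set y | p y]) <= 2^-1 - r -> (P (bad p) <= (delta / 4)%:E)%E.
  move=> mp pr.
  have g01 : 0 <= (1 - eps) * s < 2^-1.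
    rewrite mulr_ge0 ?(ltW s0)//=; last by lra.
    have : (1 - eps) * s <= s by rewrite ler_piMl ?(ltW s0)//; lra.
    by move: rt; rewrite /r; lra.
  apply: le_trans (contaminated_count_tail eps01 hY hD hindep mp g01 _) _.
    have : (1 - eps) * fine (F [set y | p y]) <= (1 - eps) * (2^-1 - r).
      by rewrite ler_pM2l//; lra.
    by rewrite /r; nra.
  have -> : delta / 4 = expR (- L).
    by rewrite expRN lnK ?posrE ?divr_gt0// invf_div.
  rewrite lee_fin ler_expR mulNr lerN2 exprMn.
  have -> : 2 * ((1 - eps) ^+ 2 * s ^+ 2) * n%:R = 4 * (1 - eps) ^+ 2 * L.
    have -> : 2 * ((1 - eps) ^+ 2 * s ^+ 2) * n%:R =
      2 * (1 - eps) ^+ 2 * (s ^+ 2 * n%:R) by ring.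
    by rewrite s2; ring.
  by rewrite ler_peMl ?ltW//; nra.
pose X i := contaminated Y Z D i.
have mX i : measurable_fun setT (X i).
  rewrite /X /contaminated.
  have mD : measurable_fun setT (fun w => (D i w)%:R : R).
    rewrite (_ : (fun w => _) = fun w => if D i w then 1 else 0).
      exact: measurable_fun_ifT.
    by apply/funext => w; case: (D i w).
  by apply: measurable_funD; apply: measurable_funM => //; exact: measurable_funB.
set good := [set w | _].
have mgood : measurable good.
  apply: measurable_bool_set; apply: measurable_fun_ler => //.
  apply: measurableT_comp => //; apply: measurable_funB => //.
  exact: measurable_emp_mad mX.
pose p1 (x : R) := m1 F + c < x.
pose p2 (x : R) := x < m1 F - 2 * c.
pose p3 (x : R) := m2 F + c < `|x - m1 F|.
pose p4 (x : R) := `|x - m1 F| < m2 F - c.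
have mp1 : measurable_fun setT p1 by exact: measurable_fun_ltr.
have mp2 : measurable_fun setT p2 by exact: measurable_fun_ltr.
have mp3 : measurable_fun setT p3.
  by apply: measurable_fun_ltr => //; exact: measurable_absdev.
have mp4 : measurable_fun setT p4.
  by apply: measurable_fun_ltr => //; exact: measurable_absdev.
have P1 := tail p1 mp1 (mass_gt_m1 hB hF r0 rB).
have P2 := tail p2 mp2 (mass_lt_m1 hB hF r0 rB).
have P3 := tail p3 mp3 (mass_absdev_gt hB hF r0 rB).
have P4 := tail p4 mp4 (mass_absdev_lt hB hF r0 rB).
have mbad p : measurable_fun setT p -> measurable (bad p).
  exact: measurable_contaminated_count.
have mU2 : measurable (bad p1 `|` bad p2) by apply: measurableU; exact: mbad.
have mU3 : measurable (bad p1 `|` bad p2 `|` bad p3) by apply: measurableU => //; exact: mbad.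
have mU4 : measurable (bad p1 `|` bad p2 `|` bad p3 `|` bad p4).
  by apply: measurableU => //; exact: mbad.
have sub : ~` good `<=` bad p1 `|` bad p2 `|` bad p3 `|` bad p4.
  move=> w; apply: contra_notP => nbad; rewrite /good/=.
  (* Where [D i w] is false, the observed value is [Y i w], so every observation satisfying [p] is
     counted in [bad p]. *)
  have few p : ~ bad p w -> (2 * count p [seq X i w | i <- enum 'I_n] <
      size [seq X i w | i <- enum 'I_n])%N.
    move=> /negP; rewrite -ltnNge size_map size_enum_ord; apply: leq_ltn_trans.
    rewrite leq_mul2l/= count_map_enum; apply: subset_leq_card.
    apply/fintype.subsetP => i; rewrite !inE /X /contaminated.
    by case: (D i w) => //=; rewrite subr0 mul1r mul0r addr0.
  apply: le_trans cE; apply: (@emp_mad_dist _ _ (m1 F)); last exact: ltW.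
  - by apply: few => h; apply: nbad; do 3!left.
  - by apply: few => h; apply: nbad; do 2!left; right.
  - by apply: few => h; apply: nbad; left; right.
  - by apply: few => h; apply: nbad; right.
have Pbad : (P (~` good) <= delta%:E)%E.
  apply: (@le_trans _ _ (P (bad p1 `|` bad p2 `|` bad p3 `|` bad p4))).
    by apply: le_measure; rewrite ?inE//; exact: measurableC.
  rewrite (_ : delta%:E =
      (delta / 4)%:E + (delta / 4)%:E + (delta / 4)%:E + (delta / 4)%:E)%E; last first.
    by rewrite -!EFinD; congr (_%:E); field.
  apply: le_trans; first by apply: measureU2 => //; exact: mbad.
  apply: leeD => //; apply: le_trans; first by apply: measureU2 => //; exact: mbad.
  apply: leeD => //; apply: le_trans; first by apply: measureU2 => //; exact: mbad.
  exact: leeD.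
rewrite -(setCK good) probability_setC; last exact: measurableC.
by rewrite EFinB; apply: leeB.
Qed.
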